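(* Let $K$ be a field and let $I\subset K[x,y]$ be a monomial ideal. If $\mu(I) \ge 6$ then $\mu(I^2) \ge 9$.
   Context: For an ideal $J$ of the polynomial ring $K[x,y]$, $\mu(J)$ denotes the least number of generators of $J$. A monomial ideal is an ideal generated by monomials $x^iy^j$ ($i,j\in\mathbb{N}$, with $0 \in \mathbb{N}$); for such an ideal $J$, $\mu(J)$ equals the cardinality of its unique minimal system of monomial generators $\mathcal{G}(J)$, which consists of all monomials in $J$ that are minimal under divisibility. *)

(* Defs.v *)
From mathcomp Require Import all_boot all_order all_algebra.
From mathcomp Require Import boolp classical_sets.
From mathcomp Require Import mpoly.

Set Implicit Arguments.
Unset Strict Implicit.
Unset Printing Implicit Defensive.

Import GRing.Theory.

Local Open Scope ring_scope.
Local Open Scope classical_set_scope.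

(* Ideals are Prop-valued sets: the boolean [idealr_closed] of ring_quotient
   excludes the unit ideal. *)
Section Ideals.
Variable R : comNzRingType.
Implicit Types (S J : set R) (f g : R) (s : seq R).

Definition is_ideal J : Prop :=
  [/\ J 0, forall f g, J f -> J g -> J (f + g) & forall r f, J f -> J (r * f)].

(* The ideal generated by S: all finite sums of r * g with g in S. *)
Definition ideal_gen S : set R :=
  [set f | exists2 c : seq (R * R),
     forall p, p \in c -> S p.2 & f = \sum_(p <- c) p.1 * p.2].

Definition ideal_mul J1 J2 : set R :=
  ideal_gen [set h | exists f g, [/\ J1 f, J2 g & h = f * g]].

Definition generated_by_card J (n : nat) : Prop :=
  exists2 s : seq R, size s = n & J = ideal_gen [set g | g \in s].

(* The default value 0 is only taken when J is not a finitely generated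
   ideal; this never happens for an ideal of K[x,y], which is Noetherian. *)
Definition mu J : nat :=
  if pselect (exists n, `[< generated_by_card J n >]) is left ex_n
  then ex_minn ex_n else 0%N.

Lemma ideal_gen_ideal S : is_ideal (ideal_gen S).
Proof.
split.
- by exists [::] => //; rewrite big_nil.
- move=> f g [c Sc ->] [d Sd ->]; exists (c ++ d); last by rewrite big_cat.
  by move=> p; rewrite mem_cat => /orP[/Sc|/Sd].
- move=> r f [c Sc ->]; exists [seq (r * p.1, p.2) | p <- c].
    by move=> p /mapP[q /Sc Sq ->].
  by rewrite big_map mulr_sumr; apply: eq_bigr => p _; rewrite mulrA.
Qed.

Lemma sub_ideal_gen S : S `<=` ideal_gen S.
Proof.
move=> f Sf; exists [:: (1, f)]; last by rewrite big_seq1 mul1r.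
by move=> p; rewrite inE => /eqP ->.
Qed.

Lemma ideal_gen_min S J : is_ideal J -> S `<=` J -> ideal_gen S `<=` J.
Proof.
move=> [J0 JD JM] SJ f [c Sc ->]; rewrite big_seq.
by apply: big_ind => // p /Sc /SJ; apply: JM.
Qed.

Lemma mu_gen J n : generated_by_card J n -> generated_by_card J (mu J).
Proof.
move=> Jn; rewrite /mu; case: pselect => [ex|[]]; last by exists n; apply/asboolP.
by case: ex_minnP => m /asboolP.
Qed.

Lemma mu_min J n : generated_by_card J n -> (mu J <= n)%N.
Proof.
move=> Jn; rewrite /mu; case: pselect => // ex.
by case: ex_minnP => m _; apply; apply/asboolP.
Qed.

End Ideals.

Definition monomial_ideal (K : fieldType) (n : nat) (J : set {mpoly K[n]}) : Prop :=
  exists M : set 'X_{1..n},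
    J = ideal_gen [set f | exists2 m, M m & f = 'X_[K, m]].

(* Main.v *)
(* For a finitely generated monomial ideal, mu counts the minimal exponents.
   Let p_0, ..., p_m (m >= 5) be the minimal exponents of I, ordered along the
   staircase, and let (i, j), i <= j, stand for the generator p_i + p_j of I^2.
   If one such sum divides another, their index intervals are equal or
   strictly nested.  Hence (0,0), (0,1), (m-1,m), (m,m) are always minimal, and
   so are one of (0,2), (1,1) and one of (m-2,m), (m-1,m-1).  If at most two
   further minimal sums existed, then the pairs (1,2), (m-2,m-1) and (1,m-1)
   would force (0,m) to be one of them; up to reversing the staircase, (1,1)
   would then divide (0,m-1), and the single remaining sum could not cover the
   rest: every candidate contradicts a few linear inequalities between the
   coordinates. *)
Require Import Defs.
From mathcomp Require Import all_boot all_order all_algebra.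
From mathcomp Require Import boolp classical_sets.
From mathcomp Require Import mpoly zify.

Set Implicit Arguments.
Unset Strict Implicit.
Unset Printing Implicit Defensive.

Import GRing.Theory.

Local Open Scope classical_set_scope.

(** * Combinatorics of sums of two points on a staircase *)

(** The point $p_i$ has coordinates [a i] and [b i], and the last index is [m]. With an index pair
    read as a sum of two points, [dom] is divisibility of the corresponding monomials. *)
Definition staircase (a b : nat -> nat) m :=
  forall i j, i < j -> j <= m -> a j < a i /\ b i < b j.

Definition dom (a b : nat -> nat) (z w : nat * nat) :=
  a z.1 + a z.2 <= a w.1 + a w.2 /\ b z.1 + b z.2 <= b w.1 + b w.2.

Lemma staircase_le a b m i j : staircase a b m -> i <= j -> j <= m ->
  a j <= a i /\ b i <= b j.
Proof.
move=> S; rewrite leq_eqVlt => /orP[/eqP-> //|ij] jm.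
by have [? ?] := S _ _ ij jm; split; exact: ltnW.
Qed.

(** Exchanging the two variables reverses the staircase. This symmetry carries arguments at the end
    0 over to the end $m$. *)
Lemma staircase_rev a b m : staircase a b m ->
  staircase (fun i => b (m - i)) (fun i => a (m - i)) m.
Proof. by move=> S i j ij jm; have [] := S (m - j) (m - i); lia. Qed.

Lemma dom_rev a b m k l i j k' l' i' j' :
  k' + l = m -> l' + k = m -> i' + j = m -> j' + i = m ->
  dom a b (k, l) (i, j) ->
  dom (fun i => b (m - i)) (fun i => a (m - i)) (k', l') (i', j').
Proof.
rewrite /dom /= => kl lk ij ji [Da Db].
have [-> -> -> ->] : [/\ m - k' = l, m - l' = k, m - i' = j & m - j' = i].
  by split; lia.
by lia.
Qed.

(** Otherwise (k, l) arises from (i, j) by moving both ends weakly in one direction, at least one of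
    them strictly. Moving right raises the [b]-sum and moving left raises the [a]-sum, so
    divisibility fails. *)
Lemma dom_nested a b m k l i j : staircase a b m ->
  k <= l <= m -> i <= j <= m -> dom a b (k, l) (i, j) ->
  k = i /\ l = j \/ i < k /\ l < j \/ k < i /\ j < l.
Proof.
move=> S /andP[kl lm] /andP[ij jm] [/= Da Db].
case: (ltngtP i k) => [ik|ki|ik]; case: (ltngtP j l) => [jl|lj|jl]; subst;
  try (by lia).
- by have := S _ _ ik; have := S _ _ jl; lia.
- by have := S _ _ ik; lia.
- by have := S _ _ ki; have := S _ _ lj; lia.
- by have := S _ _ ki; lia.
- by have := S _ _ jl; lia.
- by have := S _ _ lj; lia.
Qed.

(* Here m = n + 5, (p, q) is the minimal sum below (m-2, m), and (k, l) is the
   only minimal sum that has not been identified. *)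
Lemma no_cover_skew a b n k l p q : staircase a b n.+4.+1 ->
  k <= l <= n.+4.+1 ->
  (p = n.+3 /\ q = n.+4.+1) \/ (p = n.+4 /\ q = n.+4) ->
  dom a b (1, 1) (0, 2) -> dom a b (1, 1) (0, n.+4) ->
  dom a b (p, q) (n.+3, n.+4.+1) ->
  (forall i j, i <= j <= n.+4.+1 -> 1 < j -> i < n.+4 ->
    [\/ dom a b (1, 1) (i, j), dom a b (p, q) (i, j),
        dom a b (0, n.+4.+1) (i, j) | dom a b (k, l) (i, j)]) ->
  False.
Proof.
move=> S klm pq D02 D0 Dp cov.
have pqm : p <= q <= n.+4.+1 by lia.
have N11 i j := @dom_nested _ _ _ 1 1 i j S isT.
have Npq i j := @dom_nested _ _ _ p q i j S pqm.
have N0 i j := @dom_nested _ _ _ 0 n.+4.+1 i j S (leqnn _).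
have Nkl i j := @dom_nested _ _ _ k l i j S klm.
have S12 := S 1 2 isT isT.
have SN2 : b 2 < b n.+3 by have [] := S 2 n.+3; lia.
have SN1 : b n.+3 < b n.+4 by have [] := S n.+3 n.+4; lia.
have SN : b n.+4 < b n.+4.+1 by have [] := S n.+4 n.+4.+1; lia.
(* By nesting, (m-3, m) can lie only above (p, q) = (m-1, m-1) or above (k, l); these are the two
   surviving cases. *)
case: (cov n.+2 n.+4.+1); rewrite ?leqnn //; first by lia.
- by move=> /[dup] /N11; lia.
- move=> /[dup] /Npq Npq' D.
  have {Npq'} [? ?] : p = n.+4 /\ q = n.+4 by lia.
  subst p q.
  have Dkl : dom a b (k, l) (n.+3, n.+4).
    case: (cov n.+3 n.+4) => //; first by lia.
    + by move=> /N11; lia.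
    + by move=> /Npq; lia.
    (* Adding the [a]-parts of [D], [D0] and [D'] gives $2a_1 \le a_{m-3} + a_{m-2}$, against strict
       decrease. *)
    + move: D D0 Dp; rewrite /dom /= => D D0 Dp D'.
      by have := S 1 n.+2; have := S 1 n.+3; have := S n.+2 n.+3; lia.
  have D12 : dom a b (0, n.+4.+1) (1, 2).
    case: (cov 1 2) => //.
    + by move=> /N11; lia.
    + by move=> /Npq; lia.
    + move=> D'.
      have [? ?] : k = 0 /\ l = n.+4.+1.
        by have := Nkl _ _ _ Dkl; have := Nkl _ _ _ D'; lia.
      by subst.
  have [? ?] : k = 1 /\ l = n.+4.+1.
    have Nkl' := Nkl _ _ _ Dkl.
    case: (cov 1 n.+4.+1); rewrite ?leqnn //.
    + by move=> /N11; lia.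
    (* [D02] and [D12] give $b_1 + b_m \le 2b_2$, which is less than $2b_{m-1}$. *)
    + by move: D02 D12; rewrite /dom /=; lia.
    + by move=> /N0; lia.
    + move=> D'; have [] : (k = 1 /\ l = n.+4.+1) \/ (k = n.+3 /\ l = n.+4).
      * by have := Nkl _ _ _ D'; lia.
      * by [].
      * by case=> ? ?; subst; move: D' D02 D12; rewrite /dom /=; lia.
  subst; case: (cov 1 n.+4); rewrite ?leqnSn //.
  + by move=> /N11; lia.
  + by move=> /Npq; lia.
  (* If (0, m) divided (1, m-1), then [D0] and [Dp] would yield $a_1 \le a_{m-2}$. *)
  + by move: D0 Dp; rewrite /dom /=; have := S n.+3 n.+4; have := S 1 n.+3; lia.
  + by move=> /Nkl; lia.
- by move=> /N0; lia.
move=> Dkl; have Nkl' := Nkl _ _ _ Dkl.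
have D12 : dom a b (0, n.+4.+1) (1, 2).
  case: (cov 1 2) => //.
  + by move=> /N11; lia.
  + by move=> /Npq; lia.
  + by move=> /Nkl; lia.
case: (cov 1 n.+4.+1); rewrite ?leqnn //.
- by move=> /N11; lia.
- move=> /[dup] /Npq Npq' D; have [? ?] : p = n.+4 /\ q = n.+4 by lia.
  by subst; move: D D02 D12; rewrite /dom /=; lia.
- by move=> /N0; lia.
move=> /[dup] /Nkl Nkl2 [_ /= D].
(* Lying below both (m-3, m) and (1, m) forces $k, l \ge m-2$. Hence $b_k + b_l \ge 2b_{m-2} > 2b_2
   \ge b_1 + b_m$, a contradiction. *)
have [||_ bk] := @staircase_le _ _ _ n.+3 k S; try (by lia).
have [||_ bl] := @staircase_le _ _ _ n.+3 l S; try (by lia).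
by move: D02 D12; rewrite /dom /=; lia.
Qed.

(** Here (0, m) is one of the two unidentified sums. If (1, 1) covers (0, m-1), or (m-1, m-1) covers
    (1, m), then [no_cover_skew] applies directly or after reversal. Otherwise (k, l) divides both,
    hence also (0, m); so it equals (0, m), which divides neither. *)
Lemma no_cover_corner a b n k l p q p' q' : staircase a b n.+4.+1 ->
  k <= l <= n.+4.+1 ->
  (p = 0 /\ q = 2) \/ (p = 1 /\ q = 1) ->
  (p' = n.+3 /\ q' = n.+4.+1) \/ (p' = n.+4 /\ q' = n.+4) ->
  dom a b (p, q) (0, 2) -> dom a b (p', q') (n.+3, n.+4.+1) ->
  (forall i j, i <= j <= n.+4.+1 -> 1 < j -> i < n.+4 ->
    [\/ dom a b (p, q) (i, j), dom a b (p', q') (i, j),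
        dom a b (0, n.+4.+1) (i, j) | dom a b (k, l) (i, j)]) ->
  (dom a b (k, l) (0, n.+4.+1) -> k = 0 /\ l = n.+4.+1) ->
  False.
Proof.
move=> S klm pq pq' Dp Dp' cov kl0.
have pqm : p <= q <= n.+4.+1 by lia.
have pqm' : p' <= q' <= n.+4.+1 by lia.
have Np i j := @dom_nested _ _ _ p q i j S pqm.
have Np' i j := @dom_nested _ _ _ p' q' i j S pqm'.
have N0 i j := @dom_nested _ _ _ 0 n.+4.+1 i j S (leqnn _).
have Nkl i j := @dom_nested _ _ _ k l i j S klm.
case: (cov 0 n.+4); rewrite ?leqnSn //.
- move=> /[dup] /Np Npq D; have [? ?] : p = 1 /\ q = 1 by lia.
  by subst; apply: (no_cover_skew S klm pq' Dp D Dp' cov).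
- by move=> /Np'; lia.
- by move=> /N0; lia.
move=> Dkl; have Nkl' := Nkl _ _ _ Dkl.
case: (cov 1 n.+4.+1); rewrite ?leqnn //.
- by move=> /Np; lia.
- move=> /[dup] /Np' Npq D; have [? ?] : p' = n.+4 /\ q' = n.+4 by lia.
  subst.
  have klr : n.+4.+1 - l <= n.+4.+1 - k <= n.+4.+1 by lia.
  (* Reversal turns (p', q') = (m-1, m-1) into (1, 1) and moves (p, q) to the far end, so the first
     two alternatives of the cover are exchanged. *)
  apply: (@no_cover_skew _ _ n _ _ (n.+4.+1 - q) (n.+4.+1 - p)
           (staircase_rev S) klr).
  + by lia.
  + by apply: dom_rev Dp'; lia.
  + by apply: dom_rev D; lia.
  + by apply: dom_rev Dp; lia.
  move=> i j ijm j1 i4; case: (cov (n.+4.+1 - j) (n.+4.+1 - i)); try (by lia).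
  + by move=> H; constructor 2; apply: dom_rev H; lia.
  + by move=> H; constructor 1; apply: dom_rev H; lia.
  + by move=> H; constructor 3; apply: dom_rev H; lia.
  + by move=> H; constructor 4; apply: dom_rev H; lia.
- by move=> /N0; lia.
- move=> Dkl2; have [] : k = 0 /\ l = n.+4.+1.
    apply: kl0; move: Dkl Dkl2; rewrite /dom /=.
    by have := S 0 1; have := S n.+4 n.+4.+1; lia.
  by have := Nkl _ _ _ Dkl2; lia.
Qed.

(** Only (k, l) and (k', l') can cover the three pairs (1, 2), (m-2, m-1) and (1, m-1). One of them
    therefore covers two of these pairs, and by nesting it must be (0, m). *)
Lemma no_cover a b n k l k' l' p q p' q' : staircase a b n.+4.+1 ->
  k <= l <= n.+4.+1 -> k' <= l' <= n.+4.+1 ->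
  (p = 0 /\ q = 2) \/ (p = 1 /\ q = 1) ->
  (p' = n.+3 /\ q' = n.+4.+1) \/ (p' = n.+4 /\ q' = n.+4) ->
  dom a b (p, q) (0, 2) -> dom a b (p', q') (n.+3, n.+4.+1) ->
  (forall i j, i <= j <= n.+4.+1 -> 1 < j -> i < n.+4 ->
    [\/ dom a b (p, q) (i, j), dom a b (p', q') (i, j),
        dom a b (k, l) (i, j) | dom a b (k', l') (i, j)]) ->
  (dom a b (k, l) (k', l') -> (k, l) = (k', l')) ->
  (dom a b (k', l') (k, l) -> (k', l') = (k, l)) ->
  False.
Proof.
move=> S klm klm' pq pq' Dp Dp' cov4 kk kk'.
have pqm : p <= q <= n.+4.+1 by lia.
have pqm' : p' <= q' <= n.+4.+1 by lia.
have N k0 l0 i j : k0 <= l0 <= n.+4.+1 -> i <= j <= n.+4.+1 ->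
  dom a b (k0, l0) (i, j) -> _ := @dom_nested _ _ _ k0 l0 i j S.
wlog D12 : k l k' l' klm klm' cov4 kk kk' / dom a b (k, l) (1, 2).
  move=> W; case: (cov4 1 2) => //.
  - by move/(N _ _ _ _ pqm); lia.
  - by move/(N _ _ _ _ pqm'); lia.
  - exact: (W _ _ _ _ klm klm' cov4 kk kk').
  - apply: (W _ _ _ _ klm' klm _ kk' kk) => i j ijm j1 i4.
    by case: (cov4 i j ijm j1 i4);
      [constructor 1|constructor 2|constructor 4|constructor 3].
have : k = 0 /\ l = n.+4.+1 \/ k' = 0 /\ l' = n.+4.+1.
  move/(N _ _ _ _ klm) in D12; case: (cov4 n.+3 n.+4); try (by lia).
  - by move/(N _ _ _ _ pqm); lia.
  - by move/(N _ _ _ _ pqm'); lia.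
  - by move/(N _ _ _ _ klm); lia.
  move/(N _ _ _ _ klm') => D34; case: (cov4 1 n.+4); try (by lia).
  - by move/(N _ _ _ _ pqm); lia.
  - by move/(N _ _ _ _ pqm'); lia.
  - by move/(N _ _ _ _ klm); lia.
  - by move/(N _ _ _ _ klm'); lia.
case=> [[? ?]|[? ?]]; subst.
- apply: (no_cover_corner S klm' pq pq' Dp Dp' cov4).
  by move=> /kk' [-> ->].
- apply: (no_cover_corner S klm pq pq' Dp Dp') =>
    [i j ijm j1 i4|/kk [-> ->] //].
  by case: (cov4 i j ijm j1 i4) => H;
    [constructor 1|constructor 2|constructor 4|constructor 3].
Qed.

(** This isolates the at most two minimal sums that remain beside six known ones. *)
Lemma size_le_add2 (T : eqType) (x0 : T) (s Z : seq T) :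
  uniq s -> {subset s <= Z} -> x0 \in Z -> size Z <= size s + 2 ->
  exists x y, [/\ x \in Z, y \in Z & {subset Z <= [:: x, y & s]}].
Proof.
move=> Us sZ x0Z leZ; pose R := [seq z <- Z | z \notin s].
have RZ : {subset R <= Z} by move=> z; rewrite mem_filter => /andP[].
have nthZ i : nth x0 R i \in Z.
  by case: (ltnP i (size R)) => [/(mem_nth x0)/RZ //|/(nth_default x0) ->].
have sizeR : size R <= 2.
  have := count_predC (mem s) Z; rewrite -size_filter -[count _ Z]size_filter.
  have : size s <= size (filter (mem s) Z).
    by apply: uniq_leq_size => // z zs; rewrite mem_filter /= zs sZ.
  by rewrite -/R; lia.
(* When [R] has fewer than two entries, the default [x0] fills in, and it too lies in [Z]. *)
exists (nth x0 R 0), (nth x0 R 1); split=> // z zZ.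
case: (boolP (z \in s)) => [zs|zs]; first by rewrite !inE zs !orbT.
have : z \in R by rewrite mem_filter zs zZ.
clear RZ nthZ; clearbody R; move: sizeR.
case: R => [|u [|v []]] //= _; rewrite !inE; first by move=> ->.
by rewrite orbA => ->.
Qed.

Lemma cover_size a b m (Z : seq (nat * nat)) : 5 <= m -> staircase a b m ->
  (forall z : nat * nat, z \in Z -> z.1 <= z.2 <= m) ->
  (forall i j, i <= j <= m ->
     exists2 z : nat * nat, z \in Z & dom a b z (i, j)) ->
  (forall z w : nat * nat, z \in Z -> w \in Z -> dom a b z w -> z = w) ->
  9 <= size Z.
Proof.
move=> m5 S Zm cov anti; rewrite ltnNge; apply/negP => sizeZ.
have [n def_m] : exists n, m = n.+4.+1 by exists (m - 5); lia.
subst m.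
have N k l i j : k <= l <= n.+4.+1 -> i <= j <= n.+4.+1 ->
  dom a b (k, l) (i, j) -> _ := @dom_nested _ _ _ k l i j S.
(* No other interval lies strictly inside or strictly around these four extreme pairs, so only the
   pair itself can cover it. *)
have self i j : i <= j <= n.+4.+1 ->
      i = 0 /\ j <= 1 \/ n.+4 <= i /\ j = n.+4.+1 ->
      (i, j) \in Z.
  move=> ijm ij; have [[k l] klZ D] := cov i j ijm.
  have klm := Zm _ klZ.
  have [] : k = i /\ l = j; last by move=> <- <-.
  by have := N _ _ _ _ klm ijm D; move: klm => /=; lia.
have Z00 : (0, 0) \in Z by apply: self; lia.
have Z01 : (0, 1) \in Z by apply: self; lia.
have Z45 : (n.+4, n.+4.+1) \in Z by apply: self; lia.
have Z55 : (n.+4.+1, n.+4.+1) \in Z by apply: self; lia.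
have [|[p q] pqZ Dp] := cov 0 2; first by lia.
have pqm := Zm _ pqZ; rewrite /= in pqm.
have [|[p' q'] pqZ' Dp'] := cov n.+3 n.+4.+1; first by lia.
have pqm' := Zm _ pqZ'; rewrite /= in pqm'.
have pq : (p = 0 /\ q = 2) \/ (p = 1 /\ q = 1).
  by have := N _ _ _ _ pqm _ Dp; lia.
have pq' : (p' = n.+3 /\ q' = n.+4.+1) \/ (p' = n.+4 /\ q' = n.+4).
  by have := N _ _ _ _ pqm' _ Dp'; lia.
pose s := [:: (0, 0); (0, 1); (n.+4, n.+4.+1); (n.+4.+1, n.+4.+1);
  (p, q); (p', q')].
have Us : uniq s.
  have n1 : (n == n.+1) = false by apply: ltn_eqF.
  have n2 : (n.+1 == n) = false by apply: gtn_eqF.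
  have n3 : (n.+2 == n) = false by apply: gtn_eqF; rewrite ltnW.
  by rewrite /s; case: pq => -[-> ->]; case: pq' => -[-> ->];
    rewrite /= ?inE ?xpair_eqE ?eqSS /= n1 ?n2 ?n3 ?andbF.
have sZ : {subset s <= Z}.
  by apply/allP; rewrite /= Z00 Z01 Z45 Z55 pqZ pqZ'.
have [[k l] [[k' l'] [klZ klZ' Zsub]]] := size_le_add2 Us sZ Z00 sizeZ.
have klm := Zm _ klZ; have klm' := Zm _ klZ'; rewrite /= in klm klm'.
(* The bounds on [i] and [j] exclude the four extreme pairs, each of which divides only itself. *)
have cov4 i j : i <= j <= n.+4.+1 -> 1 < j -> i < n.+4 ->
    [\/ dom a b (p, q) (i, j), dom a b (p', q') (i, j),
        dom a b (k, l) (i, j) | dom a b (k', l') (i, j)].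
  move=> ijm j1 i4; have [z /Zsub zs D] := cov i j ijm.
  move: zs; rewrite !inE => /orP[/eqP zE|/orP[/eqP zE|]]; subst.
  - by constructor 3.
  - by constructor 4.
  do ![case/orP=> [/eqP zE|]]; last move/eqP=> zE; subst;
    try (by constructor 1); try (by constructor 2).
  - by have := N _ _ _ _ _ ijm D; lia.
  - by have := N _ _ _ _ _ ijm D; lia.
  - by have := N _ _ _ _ _ ijm D; lia.
  - by have := N _ _ _ _ _ ijm D; lia.
by apply: (no_cover S klm klm' pq pq' Dp Dp' cov4) => D; apply: anti.
Qed.

(** * Minimal exponents and the number of generators of a monomial ideal *)

Definition minimal_in n (M : set 'X_{1..n}) (m : 'X_{1..n}) :=
  M m /\ forall m', M m' -> (m' <= m)%MM -> m' = m.

Definition monomials (K : fieldType) n (M : set 'X_{1..n}) : set {mpoly K[n]} :=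
  [set f | exists2 m, M m & f = 'X_[K, m]%R].

Lemma exists_minimal n (M : set 'X_{1..n}) m :
  M m -> exists2 m', minimal_in M m' & (m' <= m)%MM.
Proof.
have [d] := ubnP (mdeg m); elim: d m => // d IH m /ltnSE md Mm.
have [[m' [Mm' lem' ne]]|no] :=
    pselect (exists m', [/\ M m', (m' <= m)%MM & m' <> m]); last first.
  exists m; last exact: lepm_refl.
  split=> // m' Mm' lem'; have [//|/eqP ne] := eqVneq m' m.
  by case: no; exists m'.
have [|m2 min2 le2] := IH m' _ Mm'; last first.
  by exists m2 => //; apply: lepm_trans le2 lem'.
apply: leq_trans md; rewrite -(submK lem') mdegD -[X in X < _]add0n ltn_add2r.
rewrite lt0n mdeg_eq0; apply/eqP => m0; apply: ne.
by rewrite -(submK lem') m0 add0m.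
Qed.

(** One coefficient per position of [g], in place of a sum of arbitrary length, provides the rows of
    a matrix. *)
Lemma ideal_gen_coord (R : comNzRingType) (g : seq R) f :
  ideal_gen [set h | h \in g] f ->
  exists r : 'I_(size g) -> R, (f = \sum_j r j * nth 0 g j)%R.
Proof.
pose span : set R :=
  [set f | exists r : 'I_(size g) -> R, (f = \sum_j r j * nth 0 g j)%R].
have span_ideal : is_ideal span.
  split.
  - by exists (fun=> 0%R); rewrite big1 // => j _; rewrite mul0r.
  - move=> _ _ [r ->] [r' ->]; exists (fun j => r j + r' j)%R.
    by rewrite -big_split; apply: eq_bigr => j _; rewrite mulrDl.
  - move=> x _ [r ->]; exists (fun j => x * r j)%R.
    by rewrite mulr_sumr; apply: eq_bigr => j _; rewrite mulrA.
apply: (ideal_gen_min span_ideal) => h /(nthP 0%R)[i ig <-].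
exists (fun j => (j == Ordinal ig)%:R)%R.
rewrite (bigD1 (Ordinal ig)) //= eqxx mul1r big1 ?addr0 // => j /negPf->.
by rewrite mul0r.
Qed.

Section MonomialIdeal.
Variables (K : fieldType) (n : nat) (M : set 'X_{1..n}).
Local Open Scope ring_scope.
Notation J := (ideal_gen (@monomials K n M)).

(** By linearity it suffices to treat multiples of one generator. A generating monomial that divides
    a minimal one equals it, so only the constant term of [r] contributes. *)
Lemma mcoeff_minimal m r (f : {mpoly K[n]}) :
  minimal_in M m -> J f -> (r * f)@_m = r@_0%MM * f@_m.
Proof.
move=> [_ minm] [c cM ->]; rewrite mulr_sumr !raddf_sum /= mulr_sumr !big_seq.
apply: eq_bigr => -[p g] /cM[/= m' Mm' ->]; rewrite mulrA.
have [lem|nle] := boolP (m' <= m)%MM.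
  rewrite (minm _ Mm' lem) -[X in _@_X](addm0 m) -[X in _ * _@_X](addm0 m).
  by rewrite !mcoeffMX rmorphM.
have coeff0 (h : {mpoly K[n]}) : (h * 'X_[m'])@_m = 0.
  rewrite mcoeffM big1 // => -[k1 k2] /= /eqP def_m; rewrite mcoeffX.
  case: eqP => [def_m'|_]; last by rewrite mulr0.
  by case/negP: nle; rewrite def_m def_m' lem_addl.
by rewrite !coeff0 mulr0.
Qed.

(* Reading the coefficients at the minimal monomials writes the identity
   matrix as a product through K^t. *)
Lemma size_minimal_le s t : uniq s -> (forall m, m \in s -> minimal_in M m) ->
  generated_by_card J t -> (size s <= t)%N.
Proof.
move=> Us smin [g <- defJ].
have gJ f : f \in g -> J f by rewrite defJ => fg; apply: sub_ideal_gen.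
have nths (i : 'I_(size s)) : nth 0%MM s i \in s by apply: mem_nth.
have coef (i : 'I_(size s)) : exists r : 'I_(size g) -> {mpoly K[n]},
    'X_[nth 0%MM s i] = \sum_j r j * nth 0 g j.
  apply: ideal_gen_coord; rewrite -defJ; apply: sub_ideal_gen.
  by exists (nth 0%MM s i) => //; have [] := smin _ (nths i).
have [r rE] := choice coef.
apply: (@mulmx1_min K _ _ (\matrix_(i, j) (r i j)@_0%MM)
  (\matrix_(j, i) (nth 0 g j)@_(nth 0%MM s i))).
apply/matrixP => i k; rewrite !mxE.
transitivity (('X_[nth 0%MM s i] : {mpoly K[n]})@_(nth 0%MM s k)).
  rewrite rE raddf_sum /=; apply: eq_bigr => j _; rewrite !mxE.
  by rewrite mcoeff_minimal //; [apply: smin|apply: gJ; apply: mem_nth].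
by rewrite mcoeffX nth_uniq.
Qed.

Lemma generated_by_minimal s : (forall m, minimal_in M m -> m \in s) ->
  (forall m, m \in s -> M m) -> generated_by_card J (size s).
Proof.
move=> smin sM; exists [seq 'X_[m] | m <- s]; first by rewrite size_map.
apply/seteqP; split; apply: ideal_gen_min; try exact: ideal_gen_ideal.
  move=> _ [m Mm ->]; have [m' /smin m's lem] := exists_minimal Mm.
  rewrite -(submK lem) mpolyXD.
  have [_ _] := ideal_gen_ideal
    [set g | g \in ([seq 'X_[m] | m <- s] : seq {mpoly K[n]})].
  by apply; apply: sub_ideal_gen; apply: map_f.
move=> _ /mapP[m ms ->]; apply: sub_ideal_gen; exists m => //.
exact: sM.
Qed.

Lemma mu_monomial t : generated_by_card J t ->
  exists s, [/\ uniq s, forall m, m \in s <-> minimal_in M m & size s = mu J].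
Proof.
move=> Jt.
pose min_list k := exists s,
  [/\ uniq s, forall m, m \in s -> minimal_in M m & size s = k].
have ex0 : exists k, `[< min_list k >] by exists 0%N; apply/asboolP; exists [::].
have bound k : `[< min_list k >] -> (k <= mu J)%N.
  move=> /asboolP[s [Us smin <-]].
  by apply: size_minimal_le Us smin _; apply: mu_gen Jt.
(* Finiteness of the set of minimal exponents is obtained here: lists of them have length at most
   [mu J], and a longest one omits none. *)
case: (ex_maxnP ex0 bound) => k /asboolP[s [Us smin <-]] maxs.
have complete m : minimal_in M m -> m \in s.
  move=> minm; apply/negPn/negP => ms.
  suff /maxs : `[< min_list (size s).+1 >] by rewrite ltnn.
  apply/asboolP; exists (m :: s); split=> //=; first by rewrite ms.
  by move=> m'; rewrite inE => /orP[/eqP->|/smin].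
exists s; split=> // [m|]; first by split; [apply: smin|apply: complete].
apply/eqP; rewrite eqn_leq bound; last by apply/asboolP; exists s.
apply: mu_min; apply: generated_by_minimal => // m /smin[] //.
Qed.

End MonomialIdeal.

(** * Products of ideals and sumsets of exponents *)

Lemma ideal_mul_gen (R : comNzRingType) (S T : set R) :
  ideal_mul (ideal_gen S) (ideal_gen T) =
  ideal_gen [set h | exists f g, [/\ S f, T g & h = (f * g)%R]].
Proof.
pose P := ideal_gen [set h | exists f g, [/\ S f, T g & h = (f * g)%R]].
(* These colon ideals allow passing from generators to arbitrary elements in one factor at a
   time. *)
have multiplier_ideal g : is_ideal [set f | P (f * g)%R].
  have [P0 PD PM] : is_ideal P := @ideal_gen_ideal _ _.
  split=> [|f f' Pf Pf'|r f Pf]; rewrite /mkset ?mul0r ?mulrDl -?mulrA.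
  - exact: P0.
  - exact: PD.
  - exact: PM.
apply/seteqP; split; apply: ideal_gen_min; try exact: ideal_gen_ideal.
  move=> _ [f [g [Sf Tg ->]]].
  apply: (ideal_gen_min (multiplier_ideal g) _ Sf) => x Sx /=; rewrite mulrC.
  apply: (ideal_gen_min (multiplier_ideal x) _ Tg) => y Ty /=; rewrite mulrC.
  by apply: sub_ideal_gen; exists x, y.
move=> _ [f [g [Sf Tg ->]]]; apply: sub_ideal_gen; exists f, g.
by split=> //; apply: sub_ideal_gen.
Qed.

(** This ensures that [mu] of the square is not the default value. *)
Lemma ideal_mul_generated (R : comNzRingType) (J1 J2 : set R) t1 t2 :
  generated_by_card J1 t1 -> generated_by_card J2 t2 ->
  generated_by_card (ideal_mul J1 J2) (t1 * t2).
Proof.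
move=> [s1 <- ->] [s2 <- ->]; rewrite ideal_mul_gen.
exists [seq (x * y)%R | x <- s1, y <- s2]; first by rewrite size_allpairs.
congr ideal_gen; apply/seteqP.
split=> [_ [f [g [fs gs ->]]]|_ /allpairsP[[f g] [fs gs ->]]].
  exact: allpairs_f.
by exists f, g.
Qed.

Definition sumset n (M1 M2 : set 'X_{1..n}) : set 'X_{1..n} :=
  [set m | exists m1 m2, [/\ M1 m1, M2 m2 & m = (m1 + m2)%MM]].

Lemma ideal_mul_monomials (K : fieldType) n (M1 M2 : set 'X_{1..n}) :
  ideal_mul (ideal_gen (@monomials K n M1)) (ideal_gen (@monomials K n M2)) =
  ideal_gen (@monomials K n (sumset M1 M2)).
Proof.
rewrite ideal_mul_gen; congr ideal_gen; apply/seteqP; split.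
  move=> _ [_ [_ [[m1 Mm1 ->] [m2 Mm2 ->] ->]]].
  by exists (m1 + m2)%MM; [exists m1, m2|rewrite mpolyXD].
move=> _ [_ [m1 [m2 [Mm1 Mm2 ->]]] ->]; exists 'X_[m1]%R, 'X_[m2]%R.
by split; [exists m1|exists m2|rewrite mpolyXD].
Qed.

(** Replacing each summand by a minimal exponent below it can only lower the sum, and minimality of
    the sum turns this into equality. *)
Lemma minimal_sumset n (M1 M2 : set 'X_{1..n}) m :
  minimal_in (sumset M1 M2) m -> sumset (minimal_in M1) (minimal_in M2) m.
Proof.
move=> [[m1 [m2 [Mm1 Mm2 def_m]]] minm].
have [m1' min1 le1] := exists_minimal Mm1.
have [m2' min2 le2] := exists_minimal Mm2.
exists m1', m2'; split=> //; apply/esym/minm.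
  by exists m1', m2'; split=> //; [case: min1|case: min2].
by apply/mnm_lepP => i; rewrite def_m !mnmDE leq_add //; apply/mnm_lepP.
Qed.

(** * Two variables: from minimal exponents to the staircase *)

Lemma lem2E (m m' : 'X_{1..2}) :
  (m <= m')%MM = (m ord0 <= m' ord0) && (m ord_max <= m' ord_max).
Proof.
apply/mnm_lepP/andP => [le|[le0 le1] i]; first by split.
case: (eqVneq i ord0) => [->//|i0]; suff -> : i = ord_max by [].
by apply/val_inj; move: i0; case: i => -[|[|]].
Qed.

(** Sorting by the first coordinate suffices: minimal exponents form an antichain, which makes that
    order strict and forces the second coordinate to decrease. *)
Lemma minimal_staircase (M : set 'X_{1..2}) s :
  uniq s -> (forall m, m \in s -> minimal_in M m) ->
  exists2 s', perm_eq s' s &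
  staircase (fun i => nth 0%MM s' i ord_max) (fun i => nth 0%MM s' i ord0)
    (size s).-1.
Proof.
move=> Us smin; pose le0 (m m' : 'X_{1..2}) := m ord0 <= m' ord0.
exists (sort le0 s) => [|i j ij jm]; first by rewrite perm_sort.
set p := nth 0%MM (sort le0 s).
have size_s : size (sort le0 s) = size s by rewrite size_sort.
have [is_ js] : i < size s /\ j < size s by split; lia.
have ps k : k < size s -> p k \in s.
  by move=> ks; rewrite -(mem_sort le0) mem_nth ?size_s.
have bij : p i ord0 <= p j ord0.
  apply: (@sorted_leq_nth _ le0 _ _ 0%MM (sort le0 s));
    rewrite ?inE ?size_s //; last exact: ltnW.
  - by move=> ? ? ?; apply: leq_trans.
  - by move=> ?; apply: leqnn.
  - by apply: sort_sorted => ? ?; apply: leq_total.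
have pij : p i <> p j.
  by move/eqP; rewrite nth_uniq ?size_s ?sort_uniq // ltn_eqF.
have anti k l : k < size s -> l < size s -> (p k <= p l)%MM -> p k = p l.
  move=> /ps/smin[Mk _] /ps/smin[_ minl]; exact: minl.
rewrite !ltnNge; split; apply/negP => le1.
  by apply: pij; apply: anti => //; rewrite lem2E bij.
have [aij|/ltnW aij] := leqP (p i ord_max) (p j ord_max).
  by apply: pij; apply: anti => //; rewrite lem2E bij.
by apply: pij; apply/esym/anti => //; rewrite lem2E le1.
Qed.

Lemma size_minimal_sumset (M : set 'X_{1..2}) (s Z : seq 'X_{1..2}) :
  uniq s -> (forall m, m \in s <-> minimal_in M m) ->
  (forall m, m \in Z <-> minimal_in (sumset M M) m) ->
  6 <= size s -> 9 <= size Z.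
Proof.
move=> Us sE ZE s6.
have [m ms|s' perm_s S] := @minimal_staircase M s Us; first by apply/sE.
have prednS : (size s).-1.+1 = size s by apply: prednK; apply: leq_trans s6.
have s'E := perm_mem perm_s; have size_s' := perm_size perm_s.
set p := nth 0%MM s' in S.
(* Each minimal exponent of the sumset is assigned one ordered index pair representing it; outside
   [Z] the value (0, 0) is a placeholder. *)
have [f fP] : exists f : 'X_{1..2} -> nat * nat, forall z, z \in Z ->
    (f z).1 <= (f z).2 <= (size s).-1 /\ z = (p (f z).1 + p (f z).2)%MM.
  suff : forall z, exists w : nat * nat, z \in Z ->
    w.1 <= w.2 <= (size s).-1 /\ z = (p w.1 + p w.2)%MM.
    by move=> /choice[f fP]; exists f.
  move=> z; have [zZ|_] := boolP (z \in Z); last by exists (0, 0).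
  have [m1 [m2 [/sE m1s /sE m2s ->]]] := minimal_sumset ((ZE z).1 zZ).
  rewrite -!s'E in m1s m2s.
  have p1 : p (index m1 s') = m1 by apply: nth_index.
  have p2 : p (index m2 s') = m2 by apply: nth_index.
  rewrite -!index_mem size_s' in m1s m2s.
  have [le12|lt21] := leqP (index m1 s') (index m2 s').
    exists (index m1 s', index m2 s') => _ /=.
    by rewrite p1 p2 le12 -ltnS prednS m2s.
  exists (index m2 s', index m1 s') => _ /=.
  by rewrite p1 p2 addmC ltnW // -ltnS prednS m1s.
rewrite -(size_map f); apply: cover_size S _ _ _; first by rewrite -ltnS prednS.
- by move=> _ /mapP[z /fP[le _] ->].
- move=> i j /andP[ij jm]; have pM k : k <= (size s).-1 -> M (p k).
    rewrite -ltnS prednS => km.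
    by have /sE[] : p k \in s by rewrite -s'E mem_nth // size_s'.
  have : sumset M M (p i + p j)%MM by exists (p i), (p j); split=> //;
      apply: pM => //; apply: leq_trans ij jm.
  case/exists_minimal => z /ZE zZ lez; exists (f z); first exact: map_f.
  by move: lez; rewrite {1}(fP _ zZ).2 lem2E !mnmDE => /andP[].
- move=> _ _ /mapP[z zZ ->] /mapP[w wZ ->] [Da Db]; congr f.
  have [_] := (ZE w).1 wZ; apply; first by have [] := (ZE z).1 zZ.
  by rewrite (fP _ zZ).2 (fP _ wZ).2 lem2E !mnmDE; apply/andP.
Qed.

(** A positive value rules out the default branch of [mu], so the bound on [mu I] already contains
    finite generation. *)
Lemma mu_gt0_generated (R : comNzRingType) (J : set R) :
  0 < mu J -> generated_by_card J (mu J).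
Proof.
rewrite {1}/mu; case: pselect => // -[t /asboolP Jt] _; exact: mu_gen Jt.
Qed.

Theorem theorem1p2 (K : fieldType) (I : set {mpoly K[2]})
  (I_monomial : monomial_ideal I) (mu_I_ge6 : (6 <= mu I)%N) :
  (9 <= mu (ideal_mul I I))%N.
Proof.
have I_fg := mu_gt0_generated (leq_trans (isT : 0 < 6) mu_I_ge6).
have I2_fg := ideal_mul_generated I_fg I_fg.
have [M defI] := I_monomial; rewrite -/(@monomials K 2 M) in defI.
rewrite defI in mu_I_ge6 I_fg I2_fg *.
rewrite ideal_mul_monomials in I2_fg *.
have [s [Us sE size_s]] := mu_monomial I_fg.
have [Z [UZ ZE <-]] := mu_monomial I2_fg.
by apply: size_minimal_sumset Us sE ZE _; rewrite size_s.
Qed.
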